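(* Let $a\in\{\alpha,\beta\}$ and let $(P,s,v)$ be an $a$-signed differential poset. Then for every $n\ge 2$, $$\sum_{x\in P_n}v(x)\,e(x)=\begin{cases}0&\text{if }a=\alpha,\\ 2^{\lfloor n/2\rfloor}&\text{if }a=\beta.\end{cases}$$
   Context: $K$ is a field of characteristic $0$. $P=\bigcup_{n\ge 0}P_n$ is a graded poset ($P_n$ is the set of elements of rank $n$) with finitely many elements of each rank and with a minimum $\hat 0\in P_0$; $x\lessdot y$ means $y$ covers $x$. $\hat KP$ is the $K$-vector space of arbitrary (possibly infinite) $K$-linear combinations of elements of $P$, and $\mathbf P=\sum_{x\in P}x\in\hat KP$. A linear map $\hat KP\to\hat KP$ is continuous if it preserves infinite linear combinations. A signing of $P$ is a pair $(s,v)$ where $s$ assigns a sign $s(x\lessdot y)\in\{\pm1\}$ to every cover relation of $P$ and $v:P\to\{\pm1\}$; the triple $(P,s,v)$ is called a signed poset. Define continuous linear operators $U,D:\hat KP\to\hat KP$ by $$Ux=\sum_{y:\,x\lessdot y}s(x\lessdot y)\,y,\qquad Dx=\sum_{y:\,y\lessdot x}s(y\lessdot x)\,v(x)\,v(y)\,y\qquad(x\in P).$$ $(P,s,v)$ is weakly signed differential if $v(\hat 0)=1$ and $UD+DU=I$ (the identity). It is an $\alpha$-signed differential poset if in addition $(U+D)\mathbf P=\mathbf P$, and a $\beta$-signed differential poset if instead in addition $(D-U)\mathbf P=\mathbf P$. For $x\in P_r$, the signed sum of chains is $e(x)=\sum s(\hat 0\lessdot x_1)s(x_1\lessdot x_2)\cdots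 s(x_{r-1}\lessdot x_r)$, the sum being over all maximal chains $\hat 0\lessdot x_1\lessdot\cdots\lessdot x_r=x$ from $\hat 0$ to $x$ (so $e(\hat 0)=1$). *)

(* Defs.v *)
From mathcomp Require Import all_boot all_order all_algebra.
From mathcomp Require Import boolp classical_sets functions cardinality fsbigop.

Set Implicit Arguments.
Unset Strict Implicit.
Unset Printing Implicit Defensive.

Import Order.TTheory GRing.Theory Num.Theory.

Local Open Scope classical_set_scope.
Local Open Scope ring_scope.

Definition covers d (P : porderType d) (x y : P) : bool :=
  `[< (x < y)%O /\ ~ exists z : P, (x < z)%O /\ (z < y)%O >].

(* The minimum of the poset is [\bot], provided by [bPOrderType]. *)
Definition graded_poset d (P : bPOrderType d) (rank : P -> nat) : Prop :=
  [/\ rank \bot%O = 0%N,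
      forall x y : P, (x < y)%O -> (rank x < rank y)%N,
      forall x y : P, covers x y -> rank y = (rank x).+1
    & forall n : nat, finite_set [set x : P | rank x = n]].

Definition is_sign (z : int) : Prop := z = 1 \/ z = -1.

(* The values of [s] outside the cover relations are irrelevant: no definition
   below uses them. *)
Definition signing d (P : bPOrderType d) (s : P -> P -> int) (v : P -> int)
    : Prop :=
  (forall x y : P, covers x y -> is_sign (s x y)) /\
  (forall x : P, is_sign (v x)).

(* Infinite linear combinations [\sum_(x in P) f x * x] of elements of [P] are
   represented by their coefficient functions [f : P -> K]. *)
Section Operators.
Variables (K : fieldType) (d : Order.disp_t) (P : bPOrderType d).
Variables (s : P -> P -> int) (v : P -> int).

Definition elt (x : P) : P -> K := fun y => (y == x)%:R.

Definition sum_all : P -> K := fun=> 1.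

(* The continuous linear map sending each [x : P] to [phi x].  It is meaningful
   when, for every [y], only finitely many [x] have [phi x y != 0]; this holds
   for [U] and [D] below because ranks are finite.  (A finitely supported sum
   [\sum_(x \in A) F x] is 0 by convention when its support is infinite.) *)
Definition continuous_ext (phi : P -> P -> K) (f : P -> K) : P -> K :=
  fun y => \sum_(x \in [set: P]) f x * phi x y.

Definition U : (P -> K) -> P -> K :=
  continuous_ext (fun x =>
    \sum_(y \in [set y | covers x y]) elt y *~ s x y).

Definition D : (P -> K) -> P -> K :=
  continuous_ext (fun x =>
    \sum_(y \in [set y | covers y x]) elt y *~ (s y x * v x * v y)).

Definition weakly_signed_differential : Prop :=
  v \bot%O = 1 /\ forall f : P -> K, U (D f) + D (U f) = f.

Definition alpha_signed_differential : Prop :=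
  weakly_signed_differential /\ U sum_all + D sum_all = sum_all.

Definition beta_signed_differential : Prop :=
  weakly_signed_differential /\ D sum_all - U sum_all = sum_all.

End Operators.

Inductive kind := alpha | beta.

Definition signed_differential (K : fieldType) (a : kind)
    d (P : bPOrderType d) (s : P -> P -> int) (v : P -> int) : Prop :=
  match a with
  | alpha => alpha_signed_differential K s v
  | beta => beta_signed_differential K s v
  end.

(* A maximal chain [\bot, x_1, ..., x_r = x] is encoded as the sequence
   [:: x_1; ...; x_r], which is empty when [x = \bot]. *)
Definition maximal_chains d (P : bPOrderType d) (x : P) : set (seq P) :=
  [set c | path (@covers d P) \bot%O c /\ last \bot%O c = x].

(* [pairmap s \bot [:: x_1; ...; x_r]] is
   [:: s \bot x_1; s x_1 x_2; ...; s x_(r-1) x_r]. *)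
Definition chain_sign d (P : bPOrderType d) (s : P -> P -> int) (c : seq P)
    : int :=
  \prod_(z <- pairmap s \bot%O c) z.

Definition signed_chains d (P : bPOrderType d) (s : P -> P -> int) (x : P)
    : int :=
  \sum_(c \in maximal_chains x) chain_sign s c.

(* Main.v *)
Require Import Defs.
From mathcomp Require Import all_boot all_order all_algebra.
From mathcomp Require Import boolp classical_sets functions cardinality fsbigop.
From mathcomp Require Import ring.

(** Write [P] for the sum of all elements.  The coefficient of the minimum in
    [D^n P] is the sum of [v x * e x] over the elements [x] of rank [n]
    ([iter_D_sum_all]): descending along a maximal chain multiplies the signs
    [s] of its covers and the products [v x * v y] of consecutive elements, and
    the latter telescope to the value of [v] at the top, because [v] takes the
    values 1 and -1 and is 1 at the minimum.

    So the task is to compute [A k], the coefficient of the minimum in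
    [D^k P].  The commutation relation [U D + D U = I] gives [D^2 U = U D^2],
    hence [D^(2m) U = U D^(2m)] and [D^(2m+1) U = D^(2m) - U D^(2m+1)].  As the
    minimum covers nothing, the image of [U] has no component along it
    ([U_bot]).  Therefore the coefficient [B k] of the minimum in [D^k U P] is 0
    for [k = 2m] and [A (2m)] for [k = 2m+1].

    In the alpha case [D P = P - U P], so [A (k+1) = A k - B k]; in the beta
    case [D P = P + U P], so [A (k+1) = A k + B k].  Both give
    [A (2m+1) = A (2m)], and [A (2m+2)] is [0] in the first case and
    [2 * A (2m)] in the second, where [A 0 = 1].  These are identities in the
    field; they transfer to the integers in characteristic 0. *)

Import Order.TTheory GRing.Theory Num.Theory.

Local Open Scope classical_set_scope.
Local Open Scope ring_scope.

(** * Preliminaries *)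

Set Implicit Arguments.
Unset Strict Implicit.

Lemma sign_sqr (z : int) : is_sign z -> z * z = 1.
Proof. by case=> ->. Qed.

Lemma mulrz_fctE (T : Type) (M : zmodType) (g : T -> M) (n : int) (x : T) :
  (g *~ n) x = g x *~ n.
Proof.
have nat_case (m : nat) : (g *+ m) x = g x *+ m.
  by elim: m => [|m IH]; rewrite ?mulr0n // !mulrS -IH.
by case: n => m; rewrite ?NegzE ?mulrNz -?pmulrn -?nat_case.
Qed.

Lemma fsum_if_eq (M : nmodType) (T : choiceType) (A : set T) (y : T) (g : M) :
  \sum_(z \in A) (if z == y then g else 0) = if y \in A then g else 0.
Proof.
case: (boolP (y \in A)) => [/set_mem Ay | /negP nAy].
  rewrite -(@fsbig_widen _ _ _ _ [set y] A); first by rewrite fsbig_set1 eqxx.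
    by move=> _ ->.
  by move=> z [_ /= zy]; case: eqP.
apply: fsbig1 => z Az; case: eqP => // zy.
by case: nAy; rewrite -zy; apply/mem_set.
Qed.

Lemma pairmap_rcons (T U : Type) (f : T -> T -> U) (x y : T) (c : seq T) :
  pairmap f x (rcons c y) = rcons (pairmap f x c) (f (last x c) y).
Proof. by elim: c x => //= z c IH x; rewrite IH. Qed.

(** * Saturated chains from the minimum *)

Section GradedPoset.
Variables (d : Order.disp_t) (P : bPOrderType d) (rank : P -> nat).
Hypothesis gradedP : graded_poset rank.
Variables (s : P -> P -> int) (v : P -> int).

Definition layer (n : nat) : set P := [set x | rank x = n].

(** All chains of length [n] from the minimum, whatever their top: the sums
    below are indexed by chains, which avoids a recursion for [signed_chains]
    over the elements of the poset. *)
Definition chains (n : nat) : set (seq P) :=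
  [set c | path (@covers d P) \bot%O c /\ size c = n].

Lemma rank_bot : rank \bot%O = 0%N.
Proof. by case: gradedP. Qed.

Lemma rank_covers (x y : P) : covers x y -> rank y = (rank x).+1.
Proof. by case: gradedP => _ _ + _; apply. Qed.

Lemma finite_layer (n : nat) : finite_set (layer n).
Proof. by case: gradedP => _ _ _; apply. Qed.

Lemma covers_bot (x : P) : covers x \bot%O = false.
Proof. by apply/negP => /rank_covers; rewrite rank_bot. Qed.

Lemma finite_upper_covers (x : P) : finite_set [set y | covers x y].
Proof.
by apply: sub_finite_set (finite_layer (rank x).+1) => y /rank_covers.
Qed.

Lemma finite_lower_covers (y : P) : finite_set [set x | covers x y].
Proof.
apply: sub_finite_set (finite_layer (rank y).-1) => x /= /rank_covers.
by rewrite /layer /= => ->.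
Qed.

Lemma rank_last (x : P) (c : seq P) :
  path (@covers d P) x c -> rank (last x c) = (rank x + size c)%N.
Proof.
elim: c x => [|y c IH] x /=; first by rewrite addn0.
by case/andP=> /rank_covers xy /IH ->; rewrite xy addSnnS.
Qed.

Lemma maximal_chainsE (n : nat) (x : P) : rank x = n ->
  maximal_chains x = chains n `&` [set c | last \bot%O c = x].
Proof.
move=> rx; apply/seteqP; split=> c /=; last by case=> -[].
case=> pc lc; split=> //; split=> //.
by rewrite -rx -lc rank_last // rank_bot.
Qed.

Lemma chains0 : chains 0 = [set [::]].
Proof.
by apply/seteqP; split=> [c [_ /size0nil]|_ ->].
Qed.

(** The step of the induction on [n] in [finite_chains] and [iter_D_bot]: a
    chain of length [n + 1] is a chain of length [n] and a cover of its top. *)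
Lemma rcons_chains (n : nat) : set_bij
  [set p : seq P * P | chains n p.1 /\ covers (last \bot%O p.1) p.2]
  (chains n.+1) (fun p => rcons p.1 p.2).
Proof.
split=> [[c y] /= [[pc sc] cy]||].
- by split; rewrite ?size_rcons ?sc // rcons_path pc.
- by move=> [c y] [c' y'] _ _ /= /rcons_inj [-> ->].
- move=> c; case/lastP: c => [[]|c y] //= [].
  rewrite rcons_path size_rcons => /andP[pc cy] [sc].
  by exists (c, y).
Qed.

Lemma finite_chains (n : nat) : finite_set (chains n).
Proof.
elim: n => [|n IH]; first by rewrite chains0; apply: finite_set1.
have [_ _ surj] := rcons_chains n.
apply: sub_finite_set surj _; apply: finite_image.
apply: sub_finite_set (finite_setX IH (finite_layer n.+1)).
move=> [c y] [/= [pc sc] cy]; split=> //=.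
by rewrite /layer /= (rank_covers cy) rank_last // rank_bot sc.
Qed.

Lemma chain_sign_rcons (c : seq P) (y : P) :
  chain_sign s (rcons c y) = chain_sign s c * s (last \bot%O c) y.
Proof. by rewrite /chain_sign pairmap_rcons big_rcons /= mulrC. Qed.

(** * The operators in coordinates *)

Section Operators.
Variable K : fieldType.
Implicit Types f g : P -> K.

(** The hypothesis on [A] cannot be dropped: a sum with infinite support is 0 by
    convention. *)
Lemma combination_coef (A : set P) (c : P -> int) (y : P) : finite_set A ->
  (\sum_(z \in A) elt K z *~ c z) y = if y \in A then (c y)%:~R else 0.
Proof.
move=> finA; rewrite fsbig_finite // fct_sumE /= -(fsum_if_eq _ y).
rewrite fsbig_finite //; apply: eq_bigr => z _.
by rewrite mulrz_fctE /elt eq_sym; case: eqP => [->|_]; rewrite ?mul0rz.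
Qed.

(** Indexing by a whole layer, instead of by the covers of [x], makes the index
    set depend on the rank of [x] only, so that sums over a chain and over [y]
    can be merged into one sum over pairs. *)
Lemma D_sum f (x : P) : D s v f x =
  \sum_(y \in layer (rank x).+1)
    if covers x y then f y * (s x y * v y * v x)%:~R else 0.
Proof.
have coef y : f y * (\sum_(z \in [set z | covers z y])
      elt K z *~ (s z y * v y * v z)) x =
    if covers x y then f y * (s x y * v y * v x)%:~R else 0.
  rewrite combination_coef; last exact: finite_lower_covers.
  have -> : (x \in [set z | covers z y]) = covers x y.
    by apply/idP/idP => [/set_mem|cxy] //; apply/mem_set.
  by case: (covers _ _); rewrite ?mulr0.
rewrite /D /continuous_ext; under eq_fsbigr do rewrite coef.
apply/esym; apply: fsbig_widen => // y [_] /= nly.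
by case: ifP => // /rank_covers.
Qed.

Lemma U_bot f : U s f \bot%O = 0.
Proof.
apply: fsbig1 => x _; rewrite combination_coef; last exact: finite_upper_covers.
by rewrite memNset ?mulr0 //= covers_bot.
Qed.

Lemma D_sub : {morph (@D K d P s v) : f g / f - g}.
Proof.
move=> f g; apply/funext => x; rewrite !fctE !D_sum.
rewrite -[- (\sum_(y \in _) _)]mulN1r mulr_fsumr -fsbig_split; last first.
  exact: finite_layer.
apply: eq_fsbigr => y _; case: ifP => _; first by rewrite mulN1r /= -mulrBl.
by rewrite mulr0 /= addr0.
Qed.

(** Peeling off the innermost [D] extends each chain upwards by one cover
    [x < y].  It contributes [s x y * v x * v y], and [v x] cancels against the
    factor [v x] of the shorter chain, leaving [v y]. *)
Lemma iter_D_bot (n : nat) f : v \bot%O = 1 -> (forall x, is_sign (v x)) ->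
  iter n (D s v) f \bot%O =
  \sum_(c \in chains n)
    f (last \bot%O c) * (v (last \bot%O c) * chain_sign s c)%:~R.
Proof.
move=> v_bot v_sign.
elim: n f => [|n IH] f.
  by rewrite chains0 fsbig_set1 /= /chain_sign big_nil v_bot !mulr1.
rewrite iterSr IH (reindex_fsbig _ _ _ _ (rcons_chains n)) /=.
transitivity (\sum_(c \in chains n) \sum_(y \in layer n.+1)
    if covers (last \bot%O c) y
    then f y * (v y * (chain_sign s c * s (last \bot%O c) y))%:~R else 0).
  apply: eq_fsbigr => c /set_mem [pc sc]; rewrite D_sum mulr_fsuml.
  rewrite rank_last // rank_bot sc; apply: eq_fsbigr => y _.
  case: ifP => _; last by rewrite mul0r.
  rewrite -[LHS]mulrA -intrM; congr (_ * _%:~R).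
  have := sign_sqr (v_sign (last \bot%O c)).
  move: (v (last _ c)) (v y) (s _ y) (chain_sign s c) => a b e g aa.
  by transitivity ((a * a) * (b * (g * e))); [ring | rewrite aa mul1r].
rewrite pair_fsbig; [|exact: finite_chains|exact: finite_layer].
rewrite -(@fsbig_widen _ _ _ _
    [set p : seq P * P | chains n p.1 /\ covers (last \bot%O p.1) p.2]);
  first last.
- by move=> [c y] [[cc ly]] /= ncy; case: ifP => // cy; case: ncy.
- move=> [c y] /= [[pc sc] cy]; split=> //=.
  by rewrite /layer /= (rank_covers cy) rank_last // rank_bot sc.
apply: eq_fsbigr => p /set_mem [_ ->].
by rewrite last_rcons chain_sign_rcons.
Qed.

Lemma sum_signed_chains (n : nat) :
  \sum_(x \in layer n) v x * signed_chains s x =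
  \sum_(c \in chains n) v (last \bot%O c) * chain_sign s c.
Proof.
transitivity (\sum_(x \in layer n) \sum_(c \in chains n)
    if x == last \bot%O c then v (last \bot%O c) * chain_sign s c else 0).
  apply: eq_fsbigr => x /set_mem rx.
  rewrite /signed_chains (maximal_chainsE rx) mulr_fsumr fsbig_mkcondr.
  apply: eq_fsbigr => c _; rewrite eq_sym.
  case: eqP => [<-|lc]; first by rewrite mem_set.
  by rewrite memNset.
rewrite exchange_fsbig; [|exact: finite_layer|exact: finite_chains].
apply: eq_fsbigr => c /set_mem [pc sc]; rewrite fsum_if_eq mem_set //.
by rewrite /layer /= rank_last // rank_bot sc.
Qed.

Lemma iter_D_sum_all (n : nat) : v \bot%O = 1 -> (forall x, is_sign (v x)) ->
  iter n (D s v) (@sum_all K d P) \bot%O =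
  (\sum_(x \in layer n) v x * signed_chains s x)%:~R.
Proof.
move=> v_bot v_sign; rewrite iter_D_bot // sum_signed_chains.
rewrite !fsbig_finite; try exact: finite_chains.
by rewrite rmorph_sum; apply: eq_bigr => c _; rewrite /sum_all mul1r.
Qed.

(** * Consequences of the commutation relation *)

Section Recurrence.
Hypothesis DU : forall f, U s (D s v f) + D s v (U s f) = f.

(** Both sides equal [D f - D U D f]: on the left since [D U = I - U D] at [f],
    on the right since [U D = I - D U] at [D f]. *)
Lemma D_D_U f : D s v (D s v (U s f)) = U s (D s v (D s v f)).
Proof.
have DUE (g : P -> K) : D s v (U s g) = g - U s (D s v g).
  by rewrite -{2}(DU g) addrC addKr.
by rewrite DUE D_sub DUE opprB addrC subrK.
Qed.

Lemma iter_D_U (m : nat) f : iter m.*2 (D s v) (U s f) =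
  U s (iter m.*2 (D s v) f).
Proof. by elim: m => //= m ->; rewrite D_D_U. Qed.

Lemma iter_D_U_even_bot (m : nat) f : iter m.*2 (D s v) (U s f) \bot%O = 0.
Proof. by rewrite iter_D_U U_bot. Qed.

Lemma iter_D_U_odd_bot (m : nat) f :
  iter m.*2.+1 (D s v) (U s f) \bot%O = iter m.*2 (D s v) f \bot%O.
Proof.
rewrite iterS iter_D_U -[in RHS](DU (iter _ _ f)) fctE.
by rewrite U_bot add0r.
Qed.
End Recurrence.
End Operators.
End GradedPoset.

(** * The theorem *)

Lemma intr_inj_pchar0 (K : fieldType) : [pchar K] =i pred0 ->
  injective (fun m : int => m%:~R : K).
Proof.
move=> /pcharf0P K0.
suff inj0 (z : int) : z%:~R = 0 :> K -> z = 0.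
  move=> m n /= mn; apply/eqP; rewrite -subr_eq0; apply/eqP/inj0.
  by rewrite intrB mn subrr.
case: z => m; rewrite ?NegzE ?mulrNz -?pmulrn.
  by move=> /eqP; rewrite K0 => /eqP ->.
by move=> /eqP; rewrite oppr_eq0 K0.
Qed.

Unset Implicit Arguments.
Set Strict Implicit.

Theorem theorem3p8 (K : fieldType) (charK0 : [pchar K] =i pred0)
    (d : Order.disp_t) (P : bPOrderType d) (rank : P -> nat)
    (s : P -> P -> int) (v : P -> int) (a : kind)
    (gradedP : graded_poset rank) (signingP : signing s v)
    (diffP : signed_differential K a s v) (n : nat) (n_ge2 : (2 <= n)%N) :
  \sum_(x \in [set x : P | rank x = n]) v x * signed_chains s x =
  match a with
  | alpha => 0
  | beta => 2 ^+ n./2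
  end.
Proof.
apply: (intr_inj_pchar0 charK0) => /=.
have [_ v_sign] := signingP.
have [v_bot DU] : weakly_signed_differential K s v by case: (a) diffP => -[].
rewrite -(iter_D_sum_all gradedP s K n v_bot v_sign).
(* The sequences [A] and [B] of the opening comment. *)
pose A k := iter k (D s v) (@sum_all K d P) \bot%O.
pose B k := iter k (D s v) (U s (@sum_all K d P)) \bot%O.
have A0 : A 0%N = 1 by [].
have B_even m : B m.*2 = 0 := iter_D_U_even_bot gradedP DU m _.
have B_odd m : B m.*2.+1 = A m.*2 := iter_D_U_odd_bot gradedP DU m _.
have iterDB k (f g : P -> K) :
    iter k (D s v) (f - g) \bot%O =
    iter k (D s v) f \bot%O - iter k (D s v) g \bot%O.
  suff -> : iter k (D s v) (f - g) = iter k (D s v) f - iter k (D s v) g by [].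
  by elim: k => // k IH; rewrite !iterS IH (D_sub gradedP).
rewrite -/(A n).
have n_half : n = (odd n + n./2.*2)%N by rewrite odd_double_half.
case: a diffP => -[_ PE].
- have AS k : A k.+1 = A k - B k.
    rewrite /A /B iterSr -iterDB -[X in X - U _ _]PE.
    by rewrite addrAC subrr add0r.
  have A2 m : A m.+1.*2 = 0.
    by rewrite doubleS AS B_odd AS B_even subr0 subrr.
  have /prednK half_succ : (0 < n./2)%N by rewrite half_gt0.
  have A_parity (b : bool) m : A (b + m.*2)%N = A m.*2.
    by case: b => //; rewrite -[LHS]/(A m.*2.+1) AS B_even subr0.
  by rewrite {1}n_half A_parity -half_succ A2.
- have AS k : A k.+1 = A k + B k.
    by apply/eqP; rewrite -subr_eq; apply/eqP; rewrite /A /B iterSr -iterDB PE.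
  have A2 m : A m.*2 = 2 ^+ m.
    elim: m => // m IH.
    rewrite doubleS AS B_odd AS B_even addr0 IH exprS.
    by rewrite mulr_natl mulr2n.
  have A_parity (b : bool) m : A (b + m.*2)%N = A m.*2.
    by case: b => //; rewrite -[LHS]/(A m.*2.+1) AS B_even addr0.
  by rewrite {1}n_half A_parity A2 rmorphXn.
Qed.
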